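(* Let $K$ be a field and $G$ a finite simple graph on $[n]$ such that $[n]$ is the disjoint union of those facets of the clique complex $\Delta(G)$ which have a free vertex. Then for every $k\ge1$ the power $I_G^k$ of the vertex cover ideal $I_G\subset K[x_1,\ldots,x_n]$ has a linear resolution.
   Context: The clique complex $\Delta(G)$ is the simplicial complex whose faces are the vertex sets of cliques (complete subgraphs) of $G$; its facets are the maximal cliques. A vertex of a facet $F$ is free if it belongs to no other facet. The vertex cover ideal is $I_G=\bigcap_{\{i,j\}\in E(G)}(x_i,x_j)$, equivalently generated by $\prod_{i\in C}x_i$ for $C$ a minimal vertex cover (a minimal set of vertices meeting every edge). An ideal has a linear resolution if it is generated in a single degree $d$ and its minimal graded free resolution has all differentials given by matrices of linear forms. *)

(* Defs.v *)
From HB Require Import structures.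
From mathcomp Require Import all_boot all_order all_algebra.
Set Implicit Arguments. Unset Strict Implicit. Unset Printing Implicit Defensive.
Import GRing.Theory.
Local Open Scope ring_scope.

Fixpoint mpoly (R : comNzRingType) (n : nat) : comNzRingType :=
  match n with
  | 0 => R
  | n'.+1 => ({poly (mpoly R n')} : comNzRingType)
  end.

(* variable x_i (for i < n); the outermost polynomial variable is x_{n-1} *)
Fixpoint mvar (R : comNzRingType) (n : nat) (i : nat) : mpoly R n :=
  match n return mpoly R n with
  | 0 => 0
  | n'.+1 => if i == n' then ('X : {poly (mpoly R n')})
             else ((mvar R n' i)%:P : {poly (mpoly R n')})
  end.

(* p is homogeneous of total degree d (the zero polynomial is homogeneous of
   every degree) *)
Fixpoint mhom (R : comNzRingType) (n : nat) : nat -> mpoly R n -> Prop :=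
  match n return nat -> mpoly R n -> Prop with
  | 0 => fun d c => d = 0%N \/ c = 0
  | n'.+1 => fun d (p : {poly (mpoly R n')}) =>
      forall j : nat, p`_j != 0 -> (j <= d)%N /\ mhom (d - j)%N p`_j
  end.

Definition ideal_span (S : comNzRingType) (A : S -> Prop) : S -> Prop :=
  fun f => exists s : seq (S * S),
      (forall p, p \in s -> A p.2) /\ f = \sum_(p <- s) p.1 * p.2.

Definition ideal_pow (S : comNzRingType) (I : S -> Prop) (k : nat) : S -> Prop :=
  ideal_span (fun f => exists s : seq S,
                 size s = k /\ (forall g, g \in s -> I g) /\ f = \prod_(g <- s) g).

(* ---------- graphs (simple graph on 'I_n given by a symmetric irreflexive relation) ---------- *)
Definition is_clique (n : nat) (e : rel 'I_n) (C : {set 'I_n}) : bool :=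
  [forall x in C, forall y in C, (x != y) ==> e x y].

Definition is_facet (n : nat) (e : rel 'I_n) (F : {set 'I_n}) : bool :=
  maxset (is_clique e) F.

Definition free_vertex (n : nat) (e : rel 'I_n) (F : {set 'I_n}) (v : 'I_n) : bool :=
  (v \in F) && [forall F' : {set 'I_n}, (is_facet e F' && (F' != F)) ==> (v \notin F')].

Definition free_facets (n : nat) (e : rel 'I_n) : {set {set 'I_n}} :=
  [set F | is_facet e F & [exists v, free_vertex e F v]].

Definition is_vertex_cover (n : nat) (e : rel 'I_n) (C : {set 'I_n}) : bool :=
  [forall x, forall y, e x y ==> (x \in C) || (y \in C)].

Definition is_min_vertex_cover (n : nat) (e : rel 'I_n) (C : {set 'I_n}) : bool :=
  minset (is_vertex_cover e) C.

Definition vertex_cover_ideal (K : fieldType) (n : nat) (e : rel 'I_n) :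
  mpoly K n -> Prop :=
  ideal_span (fun f => exists C : {set 'I_n},
                 is_min_vertex_cover e C /\ f = \prod_(i in C) mvar K n i).

(* ---------- linear resolution ----------
   I has a linear resolution: I is generated by homogeneous elements of one
   degree d (entries of A0), and there is a graded free resolution
     ... -> S^{b 2} --A 1--> S^{b 1} --A 0--> S^{b 0} --A0--> I -> 0
   (maps act on column vectors) of finite length all of whose differentials
   are matrices of linear forms. *)
Definition has_linear_resolution (K : fieldType) (n : nat) (I : mpoly K n -> Prop) : Prop :=
  exists (d : nat) (b : nat -> nat) (A0 : 'M[mpoly K n]_(1, b 0%N))
         (A : forall i : nat, 'M[mpoly K n]_(b i, b i.+1)),
    (forall j, mhom d (A0 0 j)) /\
        (forall f, ideal_span (fun g => exists j, g = A0 0 j) f <-> I f) /\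
        (forall i r c, mhom 1 (A i r c)) /\
        (forall v : 'cV[mpoly K n]_(b 0%N), A0 *m v = 0 <-> exists w, v = A 0%N *m w) /\
        (forall i (v : 'cV[mpoly K n]_(b i.+1)),
            A i *m v = 0 <-> exists w, v = A i.+1 *m w) /\
      (exists L, b L = 0%N).

(* Main.v *)
Require Import Defs.
From HB Require Import structures.
From mathcomp Require Import all_boot all_order all_algebra.
From mathcomp Require Import zify ring.

(* Choosing a free vertex in each facet of the partition gives a retraction [fv] of the
   vertices. A minimal vertex cover misses exactly one vertex of each of these facets,
   and the missed vertices outside the image of [fv] form an arbitrary independent set,
   since replacing a missed vertex by the free vertex of its facet keeps the missed set
   independent. Hence I_G^k is generated by the monomials
     u_b = prod_j x_j^(k - b_j) x_(fv j)^(b_j)      (j ranging over fv j <> j)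
   where b runs through a downset of exponents: the sums of k indicators of independent
   sets. As x_j u_b = x_(fv j) u_(b - 1_j), the cubes contained in this downset
   carry a complex of linear forms, with faces weighted by x_j and - x_(fv j). It is
   exact by induction on the downset: the cubes with a fixed maximal top corner b form
   the Koszul complex on the variables x_j with b_j > 0, which generate the colon ideal
   of the other u_c by u_b. *)

Set Implicit Arguments.
Unset Strict Implicit.
Unset Printing Implicit Defensive.

Import GRing.Theory.
Local Open Scope ring_scope.

(** * Polynomials: division by a variable, homogeneity *)

Section MPoly.
Context (R : comNzRingType).

(* The [R]-linear map dividing the monomials divisible by [x_i] and killing the
   others. *)
Fixpoint mquo (n i : nat) : mpoly R n -> mpoly R n :=
  match n return mpoly R n -> mpoly R n with
  | 0 => fun=> 0
  | n'.+1 => fun p : {poly mpoly R n'} =>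
      if i == n' then drop_poly 1 p else map_poly (@mquo n' i) p
  end.

Lemma mquo0 n i : mquo i 0 = 0 :> mpoly R n.
Proof.
case: n => [|n] //=; case: eqP => _; first by rewrite raddf0.
exact: map_poly0.
Qed.

Lemma mquoD n i (p q : mpoly R n) : mquo i (p + q) = mquo i p + mquo i q.
Proof.
elim: n p q => [|n IHn] p q /=; first by rewrite addr0.
case: eqP => _; first by rewrite raddfD.
apply/polyP=> j; rewrite !(coefD, coef_map_id0) ?mquo0 //=; exact: IHn.
Qed.

Lemma mquoK n i (p : mpoly R n) : (i < n)%N -> mquo i (mvar R n i * p) = p.
Proof.
elim: n p => [|n IHn] //= p; rewrite ltnS leq_eqVlt; case: eqP => /= [_ _|_ lt_in].
  by apply/polyP=> j; rewrite coef_drop_poly coefXM addn1.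
by apply/polyP=> j; rewrite coef_map_id0 ?mquo0 // coefCM IHn.
Qed.

Lemma mquoM n i j (p : mpoly R n) : j != i ->
  mquo i (mvar R n j * p) = mvar R n j * mquo i p.
Proof.
elim: n p => [|n IHn] p ne_ji /=; first by rewrite mul0r.
case: (eqVneq i n) => [Ei|ne_in]; case: (eqVneq j n) => [Ej|ne_jn].
- by rewrite Ei Ej eqxx in ne_ji.
- by apply/polyP=> l; rewrite !(coef_drop_poly, coefCM).
- apply/polyP=> l; rewrite !(coef_map_id0, coefXM) ?mquo0 //.
  by case: eqP => // _; rewrite mquo0.
- by apply/polyP=> l; rewrite !(coef_map_id0, coefCM) ?mquo0 // IHn.
Qed.

Lemma mhom0 n d : mhom d (0 : mpoly R n).
Proof. by case: n => [|n] /=; [right | move=> j; rewrite coef0 eqxx]. Qed.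

Lemma mhomD n d (p q : mpoly R n) : mhom d p -> mhom d q -> mhom d (p + q).
Proof.
elim: n d p q => [|n IHn] d p q /=.
  by case=> [->|->]; [left | case=> [->|->]; [left | right; rewrite addr0]].
move=> hp hq j; rewrite coefD => nz.
have [p0|pn0] := eqVneq (p`_j) 0; first by move: nz; rewrite p0 add0r; apply: hq.
have [quo0|qn0] := eqVneq (q`_j) 0; first by move: nz; rewrite quo0 addr0; apply: hp.
have [le_jd hpj] := hp j pn0; have [_ hqj] := hq j qn0.
by split=> //; apply: IHn.
Qed.

Lemma mhomN n d (p : mpoly R n) : mhom d p -> mhom d (- p).
Proof.
elim: n d p => [|n IHn] d p /=; first by case=> [->|->]; [left | right; rewrite oppr0].
by move=> hp j; rewrite coefN oppr_eq0 => /hp [? /IHn].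
Qed.

Lemma mhom1 n : mhom 0 (1 : mpoly R n).
Proof.
elim: n => [|n IHn] /=; first by left.
by move=> [|j]; rewrite coef1 //= eqxx.
Qed.

Lemma mhomVM n d i (p : mpoly R n) : mhom d p -> mhom d.+1 (mvar R n i * p).
Proof.
elim: n d p => [|n IHn] d p hp; first by right; rewrite /= mul0r.
rewrite /=; case: eqP => _ j.
  rewrite coefXM; case: j => [|j] /=; rewrite ?eqxx // => /hp [le_jd hpj].
  by split.
rewrite coefCM => nz; have pn0: p`_j != 0.
  by apply: contraNneq nz => ->; rewrite mulr0.
have [le_jd hpj] := hp j pn0; split; first exact: leqW.
by rewrite subSn //; apply: IHn.
Qed.

Lemma mhom_sum n d (I : Type) (r : seq I) (P : pred I) (F : I -> mpoly R n) :
  (forall i, P i -> mhom d (F i)) -> mhom d (\sum_(i <- r | P i) F i).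
Proof. by move=> hF; apply: big_ind => //; [apply: mhom0 | move=> p q; apply: mhomD]. Qed.

Lemma mhomXM n d i m (p : mpoly R n) : mhom d p -> mhom (m + d) (mvar R n i ^+ m * p).
Proof.
move=> hp; elim: m => [|m IHm]; first by rewrite expr0 mul1r.
by rewrite exprS -mulrA addSn; apply: mhomVM.
Qed.

End MPoly.

(** * Signs of the exterior algebra *)

Section Signs.
Context (n : nat) (S : comNzRingType).

(** The sign of inserting [j] into the increasingly ordered set [s]. *)
Definition koszul_sign (j : 'I_n) (s : {set 'I_n}) : S := (-1) ^+ #|[set l in s | (l < j)%N]|.
Local Notation sgn := koszul_sign.

Lemma sgnU1 (j l : 'I_n) (s : {set 'I_n}) :
  l \notin s -> sgn j (l |: s) = (-1) ^+ (l < j)%N * sgn j s.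
Proof.
move=> ls; rewrite /koszul_sign; case: ltnP => lj.
  have -> : [set a in l |: s | (a < j)%N] = l |: [set a in s | (a < j)%N].
    by apply/setP=> a; rewrite !inE; case: eqP => //= ->; rewrite lj.
  by rewrite cardsU1 !inE (negPf ls) exprD.
rewrite expr0 mul1r; congr (_ ^+ _); apply: eq_card => a.
by rewrite !inE; case: eqP => //= ->; rewrite ltnNge lj andbF.
Qed.

Lemma sgn_sqr (j : 'I_n) (s : {set 'I_n}) : sgn j s * sgn j s = 1.
Proof. by rewrite /koszul_sign -exprD addnn -mul2n exprM sqrrN expr1n expr1n. Qed.

Lemma sgn_swap (j l : 'I_n) (s : {set 'I_n}) : j != l -> j \notin s -> l \notin s ->
  sgn j s * sgn l (j |: s) = - (sgn l s * sgn j (l |: s)).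
Proof.
move=> jl js ls; rewrite !sgnU1 //.
have : (j : nat) != l by [].
by case: ltngtP => // _ _; rewrite expr0 expr1; ring.
Qed.

Lemma sgn_cross (j l : 'I_n) (s : {set 'I_n}) : j != l -> j \notin s -> l \notin s ->
  sgn l (j |: s) * sgn j (l |: s) = - (sgn j s * sgn l s).
Proof.
move=> jl js ls; rewrite !sgnU1 //.
have : (j : nat) != l by [].
by case: ltngtP => // _ _; rewrite expr0 expr1; ring.
Qed.

(** The pairs [(j, l)] and [(l, j)] cancel, as inserting two indices in either order gives opposite
    signs. This yields d^2 = 0 for both the Koszul and the cubical differential. *)
Lemma alternating_sum (s : {set 'I_n}) (G : 'I_n -> 'I_n -> S) :
  (forall j l, G j l = G l j) ->
  \sum_(j | j \notin s) sgn j s *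
     (\sum_(l | l \notin j |: s) sgn l (j |: s) * G j l) = 0.
Proof.
move=> Gsym; pose F j l := sgn j s * sgn l (j |: s) * G j l.
pose P (j l : 'I_n) := (j \notin s) && (l \notin s).
transitivity (\sum_j \sum_(l | P j l && (j != l)) F j l).
  rewrite [RHS](bigID (fun j => j \notin s)) /= [X in _ + X]big1 ?addr0 => [|j js].
    apply: eq_bigr => j js; rewrite mulr_sumr; apply: eq_big => [l|l _].
      by rewrite !inE negb_or /P js andbC eq_sym.
    by rewrite mulrA.
  by rewrite big_pred0 // => l; rewrite /P (negPf js).
transitivity (\sum_j \sum_(l | P j l && (j < l)%N) F j l +
              \sum_j \sum_(l | P j l && (l < j)%N) F j l).
  rewrite -big_split; apply: eq_bigr => j _.
  rewrite (bigID (fun l : 'I_n => (j < l)%N)) /=; congr (_ + _).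
    apply: eq_bigl => l; rewrite -andbA; congr (_ && _).
    by rewrite -(inj_eq val_inj) /=; case: ltngtP.
  apply: eq_bigl => l; rewrite -andbA; congr (_ && _).
  by rewrite -(inj_eq val_inj) /=; case: ltngtP.
rewrite [X in _ + X](exchange_big_dep xpredT) //= -big_split big1 // => j _.
rewrite [X in _ + X = _](eq_bigl (fun l => P j l && (j < l)%N)); last first.
  by move=> l; rewrite /P [X in X && _]andbC.
rewrite -big_split big1 // => l /andP [/andP [js ls] jl].
have ne_jl: j != l by rewrite -(inj_eq val_inj) /= ltn_eqF.
by rewrite /F (Gsym l) sgn_swap //= mulNr addNr.
Qed.
End Signs.

(** * Exactness of the Koszul complex *)

Section Koszul.
Context (n : nat) (S : comNzRingType) (X : 'I_n -> S) (q : 'I_n -> S -> S).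
Hypothesis qD : forall j f g, q j (f + g) = q j f + q j g.
Hypothesis qK : forall j f, q j (X j * f) = f.
Hypothesis qM : forall j l f, l != j -> q j (X l * f) = X l * q j f.
Local Notation sgn := (@koszul_sign n S).

(* With [q j] as [mquo], this substitutes [0] for [X j]. *)
Definition rem_at j f : S := f - X j * q j f.
Definition rem_seq (s : seq 'I_n) (f : S) : S := foldr rem_at f s.

Lemma quo0 j : q j 0 = 0.
Proof. by apply: (addrI (q j 0)); rewrite -qD !addr0. Qed.

Lemma quoN j f : q j (- f) = - q j f.
Proof. by apply: (addrI (q j f)); rewrite -qD !subrr quo0. Qed.

Lemma quo_sum j (I : Type) (r : seq I) (P : pred I) (F : I -> S) :
  q j (\sum_(i <- r | P i) F i) = \sum_(i <- r | P i) q j (F i).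
Proof. by apply: (big_morph (q j)); [apply: qD | apply: quo0]. Qed.

Lemma quo_sgnM j l s f : q j (sgn l s * f) = sgn l s * q j f.
Proof.
by rewrite /koszul_sign -signr_odd; case: odd; rewrite ?expr0 ?expr1 ?mul1r ?mulN1r ?quoN.
Qed.

Lemma rem_at0 j : rem_at j 0 = 0.
Proof. by rewrite /rem_at quo0 mulr0 subr0. Qed.

Lemma rem_seq0 s : rem_seq s 0 = 0.
Proof. by elim: s => //= j s ->; rewrite rem_at0. Qed.

Lemma rem_atD j f g : rem_at j (f + g) = rem_at j f + rem_at j g.
Proof. rewrite /rem_at qD; ring. Qed.

Lemma rem_atXM j f : rem_at j (X j * f) = 0.
Proof. by rewrite /rem_at qK subrr. Qed.

Lemma rem_atM j l f : l != j -> rem_at j (X l * f) = X l * rem_at j f.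
Proof. by move=> lj; rewrite /rem_at qM //; ring. Qed.

Definition koszul (v : {set 'I_n} -> S) (s : {set 'I_n}) : S :=
  \sum_(j | j \notin s) sgn j s * (X j * v (j |: s)).

Lemma koszulB v w s : koszul (fun t => v t - w t) s = koszul v s - koszul w s.
Proof. by rewrite -sumrB; apply: eq_bigr => j _; ring. Qed.

Lemma koszulK v s : koszul (koszul v) s = 0.
Proof.
rewrite -[RHS](@alternating_sum n S s (fun j l => X j * (X l * v (l |: (j |: s))))).
  apply: eq_bigr => j _; rewrite [X j * _]mulr_sumr; congr (_ * _).
  by apply: eq_bigr => l _; ring.
by move=> j l; rewrite mulrCA setUCA.
Qed.

(* A contracting homotopy for the [j]-th direction, up to reduction at [X j = 0]. *)
Definition koszul_htpy j (v : {set 'I_n} -> S) (s : {set 'I_n}) : S :=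
  if j \in s then sgn j (s :\ j) * q j (v (s :\ j)) else 0.

(** For [j] outside [s] only the summand [j] of the differential survives and gives
    [X j * q j (v s)]. For [j] in [s], applying [q j] to the cycle condition at [s :\ j] solves for
    [v s]. *)
Lemma koszul_htpyP j v s : (forall t, koszul v t = 0) ->
  v s - koszul (koszul_htpy j v) s = if j \in s then 0 else rem_at j (v s).
Proof.
move=> dv0; case: ifPn => js; last first.
  rewrite /rem_at; congr (_ - _).
  rewrite /koszul (bigD1 j) //= big1 => [|l /andP[ls lj]]; last first.
    by rewrite /koszul_htpy !inE eq_sym (negPf lj) (negPf js) /= !mulr0.
  rewrite /koszul_htpy setU11 setU1K // addr0 mulrCA; congr (_ * _).
  by rewrite mulrA sgn_sqr mul1r.
have jt : j \notin s :\ j by rewrite !inE eqxx.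
have := dv0 (s :\ j); set t := s :\ j in jt *.
have Es : s = j |: t by rewrite setD1K.
rewrite /koszul (bigD1 j) //= => /eqP; rewrite addr_eq0 => /eqP /(congr1 (q j)).
rewrite quo_sgnM qK quoN quo_sum -Es => /(congr1 ( *%R (sgn j t))).
rewrite mulrA sgn_sqr mul1r => ->; apply/eqP; rewrite subr_eq0; apply/eqP.
rewrite mulrN mulr_sumr -sumrN; apply: eq_big => [l|l /andP [lt lj]].
  by rewrite [in RHS]Es in_setU1 negb_or andbC.
rewrite quo_sgnM qM // /koszul_htpy in_setU1 js orbT.
have -> : (l |: s) :\ j = l |: t.
  by rewrite Es setUCA setU1K // in_setU1 negb_or eq_sym lj.
have := @sgn_cross n S j l t; rewrite -Es eq_sym => /(_ lj jt lt) E.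
transitivity ((sgn l s * sgn j (l |: t)) * (X l * q j (v (l |: t)))); last by ring.
by rewrite E; ring.
Qed.

(** Chains of degree [i] of the Koszul complex on the [X j] with [j] in [T], extended by zero. *)
Definition ksupp (T : {set 'I_n}) (i : nat) (v : {set 'I_n} -> S) :=
  forall s, v s != 0 -> s \subset T /\ #|s| = i.

(** The homotopies for the directions in [s] are applied one after the other; each makes the cycle
    vanish on sets containing its direction and reduces the other coefficients modulo its
    variable. *)
Lemma koszul_exact_seq (T : {set 'I_n}) i v (s : seq 'I_n) : {subset s <= T} ->
  ksupp T i v -> (forall t, koszul v t = 0) ->
  exists2 w, ksupp T i.+1 w &
    forall t, v t - koszul w t = if has (mem t) s then 0 else rem_seq s (v t).
Proof.
move=> sT vT dv0; elim: s sT => [|j s IHs] sT.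
  exists (fun=> 0) => [t|t]; first by rewrite eqxx.
  by rewrite /koszul big1 ?subr0 // => j _; rewrite !mulr0.
have /IHs [w wT Ew] : {subset s <= T} by move=> l ls; apply: sT; rewrite inE ls orbT.
pose v' t := v t - koszul w t.
have dv'0 t : koszul v' t = 0 by rewrite koszulB dv0 koszulK subr0.
exists (fun t => w t + koszul_htpy j v' t) => [t|t]; last first.
  have -> : v t - koszul (fun t => w t + koszul_htpy j v' t) t =
            v' t - koszul (koszul_htpy j v') t.
    rewrite /v' -addrA -opprD; congr (_ - _); rewrite -big_split.
    by apply: eq_bigr => l _ /=; ring.
  rewrite koszul_htpyP //= /v' Ew; case: ifP => //= jt.
  by case: ifP => //= _; rewrite rem_at0.
have [w0|wn0 _] := eqVneq (w t) 0; last exact: wT.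
rewrite w0 add0r /koszul_htpy; case: ifP => [jt|]; last by rewrite eqxx.
have [v'0|v'n0 _] := eqVneq (v' (t :\ j)) 0; first by rewrite v'0 quo0 mulr0 eqxx.
have [tT ct] : t :\ j \subset T /\ #|t :\ j| = i.
  have [v0|vn0] := eqVneq (v (t :\ j)) 0; last exact: vT.
  move: v'n0; rewrite /v' Ew v0 rem_seq0; case: ifP; rewrite eqxx //.
rewrite (cardsD1 j t) jt ct; split=> //.
rewrite -(setD1K jt) subUset tT andbT sub1set; apply: sT; exact: mem_head.
Qed.

(** Reducing in all directions of [T] leaves at most the coefficient at [set0], which the last
    hypothesis kills. *)
Lemma koszul_exact (T : {set 'I_n}) i v :
  ksupp T i v -> (forall t, koszul v t = 0) -> rem_seq (enum T) (v set0) = 0 ->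
  exists2 w, ksupp T i.+1 w & forall t, koszul w t = v t.
Proof.
move=> vT dv0 v00.
have [|w wT Ew] := @koszul_exact_seq T i v (enum T) _ vT dv0.
  by move=> j; rewrite mem_enum.
exists w => // t; apply/esym/eqP; rewrite -subr_eq0 Ew; case: hasP => // nht.
have [v0|vn0] := eqVneq (v t) 0; first by rewrite v0 rem_seq0.
have [tT _] := vT _ vn0; suff -> : t = set0 by rewrite v00.
apply/setP=> j; rewrite inE; apply/negP=> jt; apply: nht; exists j => //.
by rewrite mem_enum (subsetP tT).
Qed.

End Koszul.

(** * Maxima and sums over finite sequences *)

Lemma seq_argmax (T : eqType) (f : T -> nat) (s : seq T) : s != [::] ->
  exists2 x, x \in s & forall y, y \in s -> (f y <= f x)%N.
Proof.
elim: s => // a [|b s] IHs _.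
  by exists a => [|y]; rewrite inE // => /eqP ->.
have [//|x xs xmax] := IHs; have [le_ax|/ltnW le_xa] := leqP (f a) (f x).
  exists x => [|y]; first by rewrite inE xs orbT.
  by rewrite inE => /orP [/eqP -> //|]; apply: xmax.
exists a => [|y]; first exact: mem_head.
by rewrite inE => /orP [/eqP -> //|/xmax /leq_trans]; apply.
Qed.

Lemma big_uniq_supp (V : nmodType) (T : eqType) (s1 s2 : seq T) (F : T -> V) :
  uniq s1 -> uniq s2 ->
  (forall x, x \in s1 -> x \notin s2 -> F x = 0) ->
  (forall x, x \in s2 -> x \notin s1 -> F x = 0) ->
  \sum_(x <- s1) F x = \sum_(x <- s2) F x.
Proof.
move=> u1 u2 F1 F2; rewrite (bigID (mem s2)) [RHS](bigID (mem s1)) /=.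
rewrite [X in _ + X]big_seq_cond [X in _ = _ + X]big_seq_cond.
rewrite [X in _ + X]big1 => [|x /andP[] //]; last exact: F1.
rewrite [X in _ = _ + X]big1 => [|x /andP[] //]; last exact: F2.
congr (_ + _); rewrite -big_filter -[RHS]big_filter; apply: perm_big.
apply: uniq_perm; rewrite ?filter_uniq // => x.
by rewrite !mem_filter andbC.
Qed.

(** * The cubical complex of a downset of exponents *)

Section Cubical.
Context (n : nat) (S : comNzRingType) (X : 'I_n -> S) (q : 'I_n -> S -> S).
Hypothesis qD : forall j f g, q j (f + g) = q j f + q j g.
Hypothesis qK : forall j f, q j (X j * f) = f.
Hypothesis qM : forall j l f, l != j -> q j (X l * f) = X l * q j f.
Context (fv : 'I_n -> 'I_n) (k : nat).
Hypothesis fvK : forall j, fv (fv j) = fv j.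
Local Notation sgn := (@koszul_sign n S).
Local Notation expo := {ffun 'I_n -> nat}.
Local Notation rem_at := (rem_at X q).
Local Notation rem_seq := (rem_seq X q).

Definition inc (j : 'I_n) (b : expo) : expo := [ffun l => (b l + (l == j))%N].
Definition supp (b : expo) : {set 'I_n} := [set j | (0 < b j)%N].

Lemma incC j l b : inc j (inc l b) = inc l (inc j b).
Proof. by apply/ffunP=> a; rewrite !ffunE addnAC. Qed.

Lemma inc_inj j : injective (inc j).
Proof.
by move=> b c /ffunP E; apply/ffunP=> l; move: (E l); rewrite !ffunE => /addIn.
Qed.

(* [b] counts how often [j] is missed by a product of [k] covers; each cover then
   contains the free vertex [fv j] instead. *)
Definition gen (b : expo) : S :=
  \prod_(j | fv j != j) (X j ^+ (k - b j) * X (fv j) ^+ b j).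

(* The cell [(b, s)] is the cube of exponents between [b - 1_s] and [b]; the two
   faces in direction [j] carry the coefficients [X j] and [- X (fv j)]. Chains are
   functions on cells, so a face is read off from the cubes it bounds. *)
Definition cube_diff (v : expo -> {set 'I_n} -> S) (b : expo) (s : {set 'I_n}) : S :=
  \sum_(j | j \notin s)
     sgn j s * (X j * v b (j |: s) - X (fv j) * v (inc j b) (j |: s)).

Lemma eq_cube_diff v w : (forall b s, v b s = w b s) ->
  forall b s, cube_diff v b s = cube_diff w b s.
Proof. by move=> E b s; apply: eq_bigr => j _; rewrite !E. Qed.

Lemma cube_diffD v w b s :
  cube_diff (fun b t => v b t + w b t) b s = cube_diff v b s + cube_diff w b s.
Proof. by rewrite -big_split; apply: eq_bigr => j _ /=; ring. Qed.

Lemma cube_diffB v w b s :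
  cube_diff (fun b t => v b t - w b t) b s = cube_diff v b s - cube_diff w b s.
Proof. by rewrite -sumrB; apply: eq_bigr => j _ /=; ring. Qed.

Lemma cube_diffK v b s : cube_diff (cube_diff v) b s = 0.
Proof.
(* The four cubes having [(b, s)] as a face of codimension two in the directions [j] and [l]. *)
pose G j l := X j * (X l * v b (l |: (j |: s)) - X (fv l) * v (inc l b) (l |: (j |: s)))
  - X (fv j) * (X l * v (inc j b) (l |: (j |: s))
                - X (fv l) * v (inc l (inc j b)) (l |: (j |: s))).
rewrite -[RHS](@alternating_sum n S s G).
  apply: eq_bigr => j _; rewrite ![X _ * _]mulr_sumr -sumrB; congr (_ * _).
  by apply: eq_bigr => l _; rewrite /G; ring.
by move=> j l; rewrite /G setUCA incC; ring.
Qed.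

(** Chains of degree [i] on the cubes inside [E]: in a downset it is enough to test the top corner,
    and [s \subset supp b] keeps the bottom corner nonnegative. *)
Definition csupp (E : seq expo) (i : nat) (v : expo -> {set 'I_n} -> S) :=
  forall b s, v b s != 0 -> [&& b \in E, s \subset supp b & #|s| == i].

(** The bound by [k] makes [k - b j] in [gen] a true difference; the last clause confines exponents
    to the vertices moved by [fv]. *)
Definition is_downset (E : seq expo) :=
  [/\ uniq E, forall b j, inc j b \in E -> b \in E,
      forall (b : expo) j, b \in E -> (b j <= k)%N &
      forall (b : expo) j, b \in E -> (0 < b j)%N -> fv j != j].

Definition augment (E : seq expo) (v : expo -> {set 'I_n} -> S) : S :=
  \sum_(b <- E) gen b * v b set0.

Lemma augmentB E v w :
  augment E (fun b s => v b s - w b s) = augment E v - augment E w.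
Proof. by rewrite -sumrB; apply: eq_bigr => b _; ring. Qed.

(** Only the factor at [j] changes, one [X j] being traded for [X (fv j)]. These linear syzygies are
    the edges of the cubes. *)
Lemma gen_inc (b : expo) j : fv j != j -> (b j < k)%N ->
  X (fv j) * gen b = X j * gen (inc j b).
Proof.
move=> fj bk; rewrite /gen (bigD1 j) // [in RHS](bigD1 j) //=.
have -> : \prod_(i | (fv i != i) && (i != j))
    (X i ^+ (k - inc j b i) * X (fv i) ^+ inc j b i) =
  \prod_(i | (fv i != i) && (i != j)) (X i ^+ (k - b i) * X (fv i) ^+ b i).
  by apply: eq_bigr => i /andP [_ /negPf ij]; rewrite ffunE ij addn0.
rewrite ffunE eqxx addn1 exprS; have -> : (k - b j = (k - (b j).+1).+1)%N by lia.
by rewrite exprS; ring.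
Qed.

Lemma supp_inc b j : supp (inc j b) = j |: supp b.
Proof. by apply/setP=> l; rewrite !inE ffunE; case: eqP; lia. Qed.

Lemma cube_diff_supp E i v : is_downset E -> csupp E i.+1 v -> csupp E i (cube_diff v).
Proof.
case=> [_ Edown _ _] vE b s; apply: contraNT => nv.
rewrite /cube_diff big1 // => j js.
have [v1|/vE /and3P [bE sb cs]] := eqVneq (v b (j |: s)) 0; last first.
  move: sb cs nv; rewrite cardsU1 js subUset bE => /andP [_ ->].
  by rewrite add1n eqSS => ->.
(* The cell is now the lower face of a cube with top corner [inc j b]: downward closure puts [b] in
   [E], and [j \notin s] keeps [s] inside [supp b]. *)
have [v2|/vE /and3P [bE sb cs]] := eqVneq (v (inc j b) (j |: s)) 0; last first.
  case/negP: nv; move: cs; rewrite (Edown _ _ bE) cardsU1 js add1n eqSS => ->.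
  rewrite andbT /=; rewrite supp_inc in sb.
  apply/subsetP=> l ls; have := subsetP sb l; rewrite !inE ls orbT => /(_ isT).
  by case: eqP => // lj; rewrite lj (negPf js) in ls.
by rewrite v1 v2; ring.
Qed.

(** For each direction [j], [gen_inc] turns the two terms into values of one function [F] at [b] and
    at [inc j b]. The shifted family still contains the support of [F], so the two sums cancel. *)
Lemma augment_cube_diff E w : is_downset E -> csupp E 1 w ->
  augment E (cube_diff w) = 0.
Proof.
move=> [Eu Edown Ek Ef] wE; rewrite /augment.
under eq_bigr => b _ do rewrite mulr_sumr.
rewrite exchange_big big1 // => j _.
pose F b := X j * gen b * w b [set j].
transitivity (\sum_(b <- E) F b - \sum_(b <- map (inc j) E) F b).
  rewrite big_map -sumrB big_seq [RHS]big_seq; apply: eq_bigr => b bE.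
  have -> : sgn j set0 = 1.
    rewrite /koszul_sign (_ : [set l in set0 | _] = set0) ?cards0 //.
    by apply/setP=> l; rewrite !inE.
  rewrite setU0 /F mul1r mulrBr; congr (_ - _); first by ring.
  have [->|wn0] := eqVneq (w (inc j b) [set j]) 0; first by rewrite !mulr0.
  have /and3P [ibE _ _] := wE _ _ wn0.
  rewrite -gen_inc; first by ring.
    by apply: (Ef _ _ ibE); rewrite ffunE eqxx addn1.
  by have := Ek _ j ibE; rewrite ffunE eqxx addn1.
apply/eqP; rewrite subr_eq0; apply/eqP; apply: big_uniq_supp => //.
- by rewrite map_inj_uniq //; apply: inc_inj.
- move=> b bE nb; rewrite /F; have [->|wn0] := eqVneq (w b [set j]) 0.
    by rewrite mulr0.
  have /and3P [_ sb _] := wE _ _ wn0; case/negP: nb; apply/mapP.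
  move: sb; rewrite sub1set inE => bj.
  have Eb : b = inc j [ffun l => (b l - (l == j))%N].
    by apply/ffunP=> l; rewrite !ffunE; case: eqP => [->|_] /=; lia.
  exists [ffun l => (b l - (l == j))%N] => //.
  by apply: (Edown _ j); rewrite -Eb.
- move=> b _ nb; rewrite /F; have [->|wn0] := eqVneq (w b [set j]) 0.
    by rewrite mulr0.
  by have /and3P [bE _ _] := wE _ _ wn0; rewrite bE in nb.
Qed.

(* The coefficient of [X j ^+ m] in [f], as a polynomial free of [X j]. *)
Definition extract (j : 'I_n) (m : nat) (f : S) : S := rem_at j (iter m (q j) f).
(** When [fv j != j], the exponent of [X j] in [gen b] is [k - b j]. *)
Definition extract_seq (b : expo) (s : seq 'I_n) (f : S) : S :=
  foldr (fun j => extract j (k - b j)) f s.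

Lemma extractD j m f g : extract j m (f + g) = extract j m f + extract j m g.
Proof.
rewrite /extract -rem_atD //; congr (rem_at j _).
by elim: m => //= m ->; rewrite qD.
Qed.

Lemma extractM j m l f : l != j -> extract j m (X l * f) = X l * extract j m f.
Proof.
move=> lj; rewrite /extract -rem_atM //; congr (rem_at j _).
by elim: m => //= m ->; rewrite qM.
Qed.

Lemma extractXM j m a f : (m <= a)%N ->
  extract j m (X j ^+ a * f) = rem_at j (X j ^+ (a - m) * f).
Proof.
elim: m a => [|m IHm] [|a] //.
by move=> /IHm; rewrite /extract iterSr exprS -mulrA qK.
Qed.

Lemma extract0 j m : extract j m 0 = 0.
Proof. by apply: (addrI (extract j m 0)); rewrite -extractD !addr0. Qed.

Lemma extract_seq0 b s : extract_seq b s 0 = 0.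
Proof. by elim: s => //= j s ->; rewrite extract0. Qed.

Lemma extract_seqD b s f g :
  extract_seq b s (f + g) = extract_seq b s f + extract_seq b s g.
Proof. by elim: s => //= j s ->; rewrite extractD. Qed.

Lemma extract_seqXM b s l m f : l \notin s ->
  extract_seq b s (X l ^+ m * f) = X l ^+ m * extract_seq b s f.
Proof.
move=> ls; elim: m => [|m IHm]; first by rewrite expr0 !mul1r.
rewrite exprS -!mulrA -IHm; elim: s ls {IHm} => //= j s IHs.
rewrite inE negb_or => /andP [lj /IHs ->]; exact: extractM.
Qed.

Lemma extract_seq_lead b s f : uniq s ->
  extract_seq b s ((\prod_(j <- s) X j ^+ (k - b j)) * f) = rem_seq s f.
Proof.
elim: s f => [|j s IHs] f /=; first by rewrite big_nil mul1r.
case/andP=> js us; rewrite big_cons -mulrA extract_seqXM // IHs //.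
by rewrite extractXM // subnn expr0 mul1r.
Qed.

(** After division by [X j ^+ (k - b j)] a factor [X j] is left, which [rem_at j] kills. *)
Lemma extract_seq_kill (b : expo) s j a f : uniq s -> j \in s -> (k - b j < a)%N ->
  extract_seq b s (X j ^+ a * f) = 0.
Proof.
elim: s => //= l s IHs /andP [ls us]; rewrite inE.
have [->|lj /= js ka] := eqVneq j l; last by rewrite IHs // extract0.
move=> _ ka /=; rewrite extract_seqXM // extractXM; last exact: ltnW.
have -> : (a - (k - b l) = (a - (k - b l)).-1.+1)%N by lia.
by rewrite exprS -mulrA rem_atXM.
Qed.

Lemma rem_seqM s l f : l \notin s -> rem_seq s (X l * f) = X l * rem_seq s f.
Proof.
by elim: s => //= j s IHs; rewrite inE negb_or => /andP [lj /IHs ->]; rewrite rem_atM.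
Qed.

(* The colon ideal of the generators preceding [gen b0] is generated by the variables
   [X j] with [0 < b0 j]: every other generator is divisible by a higher power of some
   such [X j] than [gen b0] is. *)
Lemma rem_leading E (b0 : expo) v : is_downset E -> b0 \in E ->
  (forall b : expo, b \in E -> b != b0 -> exists j, (b j < b0 j)%N) ->
  augment E v = 0 -> rem_seq (enum (supp b0)) (v b0 set0) = 0.
Proof.
move=> [Eu Edown Ek Ef] b0E b0max.
rewrite /augment (bigD1_seq b0) //= => /(congr1 (extract_seq b0 (enum (supp b0)))).
set s := enum _; have us : uniq s by apply: enum_uniq.
have sE j : (j \in s) = (0 < b0 j)%N by rewrite mem_enum inE.
rewrite extract_seq0 extract_seqD [X in _ + X](_ : _ = 0) ?addr0; last first.
  rewrite big_seq_cond; apply: (big_ind (fun f => extract_seq b0 s f = 0)).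
  - exact: extract_seq0.
  - by move=> f g Ef' Eg; rewrite extract_seqD Ef' Eg addr0.
  move=> b /andP [bE /(b0max _ bE) [j bj]].
  have js : j \in s by rewrite sE; lia.
  have fj : fv j != j by apply: (Ef _ _ b0E); rewrite -sE.
  rewrite /gen (bigD1 j) //= -!mulrA extract_seq_kill //.
  by have := Ek _ j b0E; lia.
(* [cancel R] says that [R] is a nonzerodivisor modulo the [X j] with [j] in [s]. Variables outside
   [s] have this property, hence so has the part of [gen b0] that remains after the extraction. *)
pose cancel R := forall f, rem_seq s (R * f) = 0 -> rem_seq s f = 0.
have cancelM R1 R2 : cancel R1 -> cancel R2 -> cancel (R1 * R2).
  by move=> c1 c2 f; rewrite -mulrA => /c1 /c2.
have cancel1 : cancel 1 by move=> f; rewrite mul1r.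
have cancelX l m : fv l == l \/ b0 l = 0%N -> cancel (X l ^+ m).
  move=> hl; elim: m => [|m IHm] //; rewrite exprS; apply: cancelM => // f.
  rewrite rem_seqM; first by move=> /(congr1 (q l)); rewrite qK quo0.
  rewrite sE -leqNgt leqn0; case: hl => [fl|-> //].
  by case: posnP => // bl; move: (Ef _ _ b0E bl); rewrite fl.
have -> : gen b0 = (\prod_(j <- s) X j ^+ (k - b0 j)) *
    ((\prod_(j | (fv j != j) && (j \notin s)) X j ^+ (k - b0 j)) *
     \prod_(j | fv j != j) X (fv j) ^+ b0 j).
  rewrite /gen big_split mulrA; congr (_ * _).
  rewrite (bigID (mem s)) /=; congr (_ * _); rewrite [RHS]big_uniq //=.
  apply: eq_bigl => j; apply: andb_idl; rewrite sE; exact: Ef.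
rewrite -mulrA extract_seq_lead //; apply/cancelM.
  apply: (big_ind cancel) => // j /andP [_]; rewrite sE -leqNgt leqn0 => /eqP bj.
  by apply: cancelX; right.
by apply: (big_ind cancel) => // j _; apply: cancelX; left; rewrite fvK.
Qed.

(* Removing an exponent [b0] of maximal weight keeps [E] a downset, and the quotient
   complex is the Koszul complex on the [X j] with [0 < b0 j]. *)
Lemma exact_cube E i v : is_downset E -> csupp E i v ->
  (forall b s, cube_diff v b s = 0) -> (i = 0%N -> augment E v = 0) ->
  exists2 w, csupp E i.+1 w & forall b s, cube_diff w b s = v b s.
Proof.
have [m] := ubnP (size E); elim: m => // m IHm in E v *; rewrite ltnS => szE.
move=> EP vE dv0 av0; have [Eu Edown Ek Ef] := EP.
have [E0|En0] := eqVneq E [::].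
  have v0 b s : v b s = 0.
    by apply/eqP; apply: contraT => /vE; rewrite E0 in_nil.
  exists (fun _ _ => 0) => b s; first by rewrite eqxx.
  by rewrite v0 /cube_diff big1 // => j _; ring.
have [b0 b0E b0max] := seq_argmax (fun b : expo => \sum_l b l)%N En0.
(* The weight of [inc j b0] would exceed the maximum. Hence the differential at [b0] has only its
   Koszul terms. *)
have inc_b0 j : inc j b0 \notin E.
  apply/negP=> /b0max; rewrite leqNgt => /negP [].
  rewrite [X in (_ < X)%N](_ : _ = (\sum_l b0 l).+1) //.
  rewrite (eq_bigr (fun l => b0 l + (l == j))%N) => [|l _]; last by rewrite ffunE.
  rewrite big_split /= [X in (_ + X)%N](bigD1 j) //= eqxx.
  by rewrite [X in (_ + (_ + X))%N]big1 ?addn0 ?addn1 // => l /negPf ->.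
(* If [b0] were below [b] in all coordinates, maximality would force equal weights and so
   [b = b0]. *)
have b0min (b : expo) : b \in E -> b != b0 -> exists j, (b j < b0 j)%N.
  move=> bE ne; apply/existsP; apply: contraNT ne; rewrite negb_exists => /forallP le.
  have le' j : (b0 j <= b j ?= iff (b0 j == b j))%N by split=> //; rewrite leqNgt.
  have [_ Eb] := leqif_sum (P := xpredT) (fun j _ => le' j).
  have : (\sum_j b0 j == \sum_j b j)%N.
    rewrite eqn_leq b0max // andbT; apply: leq_sum => j _; exact: (le' j).1.
  by rewrite Eb => /forallP E0; apply/eqP/ffunP=> j; apply/esym/eqP/E0.
have v_inc j s : v (inc j b0) s = 0.
  by apply/eqP; apply: contraT => /vE /and3P []; rewrite (negPf (inc_b0 j)).
have vb0T : ksupp (supp b0) i (v b0) by move=> s /vE /and3P [_ ? /eqP].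
have koszul_b0 s : koszul X (v b0) s = 0.
  rewrite -(dv0 b0 s); apply: eq_bigr => j _; rewrite v_inc; ring.
(* In positive degree [v b0] vanishes at [set0] by cardinality; in degree zero the augmentation is
   needed. *)
have lead0 : rem_seq (enum (supp b0)) (v b0 set0) = 0.
  case: (posnP i) => [/av0 /(rem_leading EP b0E b0min) //|i0].
  suff -> : v b0 set0 = 0 by rewrite rem_seq0.
  by apply/eqP; apply: contraT => /vE /and3P [_ _]; rewrite cards0; case: (i) i0.
have [wb wbT Ewb] := koszul_exact qD qK qM vb0T koszul_b0 lead0.
(* Subtracting the boundary of [wb], placed on the cubes with top corner [b0], clears [v] at [b0]
   and leaves a cycle on [E']. *)
pose w1 b s := if b == b0 then wb s else 0.
have w1E : csupp E i.+1 w1.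
  move=> b s; rewrite /w1; have [->|_] := eqVneq b b0; last by rewrite eqxx.
  by case/wbT => sT cs; rewrite b0E sT cs eqxx.
pose v' b s := v b s - cube_diff w1 b s.
pose E' := rem b0 E.
have v'b0 s : v' b0 s = 0.
  apply/eqP; rewrite subr_eq0 -Ewb; apply/eqP/eq_bigr => j _.
  have /negPf ne : inc j b0 != b0 by apply: contraNneq (inc_b0 j) => ->.
  by rewrite /w1 eqxx ne; ring.
have E'P : is_downset E'.
  split.
  - exact: rem_uniq.
  - move=> b j; rewrite !mem_rem_uniq // !inE => /andP [_ bE].
    rewrite (Edown _ _ bE) andbT; apply: contraTneq bE => ->; exact: inc_b0.
  - by move=> b j /mem_rem; apply: Ek.
  - by move=> b j /mem_rem; apply: Ef.
have v'E' : csupp E' i v'.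
  move=> b s nz; rewrite mem_rem_uniq // inE.
  have -> /= : b != b0 by apply: contraNneq nz => ->; rewrite v'b0.
  have [v0|/vE -> //] := eqVneq (v b s) 0.
  apply: (cube_diff_supp EP w1E); apply: contraNneq nz => d0.
  by rewrite /v' v0 d0 subr0.
have dv'0 b s : cube_diff v' b s = 0 by rewrite cube_diffB dv0 cube_diffK subr0.
have av'0 : i = 0%N -> augment E' v' = 0.
  move=> i0; have := augmentB E v (cube_diff w1).
  rewrite (av0 i0) augment_cube_diff ?subr0 //; last by rewrite -i0.
  rewrite /augment (perm_big _ (perm_to_rem b0E)) big_cons /=.
  by rewrite -/(v' b0 set0) v'b0 mulr0 add0r.
have [|w2 w2E' Ew2] := IHm E' v' _ E'P v'E' dv'0 av'0.
  by rewrite size_rem //; case: (E) En0 szE.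
exists (fun b s => w1 b s + w2 b s) => b s; last first.
  by rewrite cube_diffD Ew2 /v' addrC subrK.
have [->|/w1E //] := eqVneq (w1 b s) 0.
by rewrite add0r => /w2E' /andP [/mem_rem ->].
Qed.

End Cubical.

(** * Matrices of the cubical complex *)

Section Matrices.
Context (K : fieldType) (n : nat) (fv : 'I_n -> 'I_n) (k : nat).
Hypothesis fvK : forall j, fv (fv j) = fv j.
Local Notation S := (mpoly K n).
Local Notation expo := {ffun 'I_n -> nat}.
Let X (j : 'I_n) : S := mvar K n j.
Let q (j : 'I_n) : S -> S := @mquo K n j.
Local Notation gen := (gen X fv k).
Local Notation diff := (cube_diff X fv).

Let qD j f g : q j (f + g) = q j f + q j g. Proof. exact: mquoD. Qed.
Let qK j f : q j (X j * f) = f. Proof. exact: mquoK. Qed.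
Let qM j l f : l != j -> q j (X l * f) = X l * q j f.
Proof. by move=> lj; apply: mquoM. Qed.

Context (E : seq expo).
Hypothesis EP : is_downset fv k E.

Definition cells (i : nat) : seq (expo * {set 'I_n}) :=
  [seq p : expo * {set 'I_n} <- [seq (b, s) | b <- E, s <- enum {: {set 'I_n}}]
   | (p.2 \subset supp p.1) && (#|p.2| == i)].

Lemma cells_uniq i : uniq (cells i).
Proof.
have [Eu _ _ _] := EP; apply: filter_uniq.
by apply: allpairs_uniq => //; [apply: enum_uniq | move=> [? ?] [? ?]].
Qed.

Lemma mem_cells i b s : ((b, s) \in cells i) = [&& b \in E, s \subset supp b & #|s| == i].
Proof.
rewrite mem_filter /= andbC; congr (_ && _).
apply/allpairsP/idP => [[[c t] /= [cE _ [-> _]]] // | bE].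
by exists (b, s); rewrite mem_enum.
Qed.

Definition cell i (c : 'I_(size (cells i))) := tnth (in_tuple (cells i)) c.

Definition delta i (c : 'I_(size (cells i))) (b : expo) (s : {set 'I_n}) : S :=
  ((b, s) == cell c)%:R.

(** [chain] extends coordinates by zero off the cells, and [column] reads them back; the two
    translate between matrices and functions on cells. *)
Definition chain i (v : 'cV[S]_(size (cells i))) b s : S := \sum_c v c 0 * delta c b s.

Definition column i (w : expo -> {set 'I_n} -> S) : 'cV[S]_(size (cells i)) :=
  \col_c w (cell c).1 (cell c).2.

Lemma cell_inj i : injective (@cell i).
Proof. by apply/tuple_uniqP; apply: cells_uniq. Qed.

Lemma chain_cell i v (c : 'I_(size (cells i))) : chain v (cell c).1 (cell c).2 = v c 0.
Proof.
rewrite /chain (bigD1 c) //= big1 => [|c' ne].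
  by rewrite /delta -surjective_pairing eqxx mulr1 addr0.
by rewrite /delta -surjective_pairing (inj_eq (@cell_inj i)) eq_sym (negPf ne) mulr0.
Qed.

Lemma cell_mem i (c : 'I_(size (cells i))) : cell c \in cells i.
Proof. exact: mem_tnth. Qed.

Lemma chain_supp i v : csupp E i (chain (i := i) v).
Proof.
move=> b s; rewrite -mem_cells; apply: contraNT => nbs.
rewrite /chain big1 // => c _; rewrite /delta; case: eqP => [bs|]; last by rewrite mulr0.
by rewrite bs cell_mem in nbs.
Qed.

Lemma cellP i b s : (b, s) \in cells i -> exists c : 'I_(size (cells i)), cell c = (b, s).
Proof. by case/(tnthP (in_tuple (cells i))) => c ->; exists c. Qed.

Lemma columnK i w : csupp E i w -> forall b s, chain (column i w) b s = w b s.
Proof.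
move=> wE b s; have [/cellP [c Ec]|nbs] := boolP ((b, s) \in cells i).
  by have := chain_cell (column i w) c; rewrite mxE Ec.
have w0 : w b s = 0.
  by apply/eqP; apply: contraT => /wE; rewrite -mem_cells (negPf nbs).
rewrite w0; apply/eqP; apply: contraT => /(@chain_supp i).
by rewrite -mem_cells (negPf nbs).
Qed.

Definition cube_mx i : 'M[S]_(size (cells i), size (cells i.+1)) :=
  \matrix_(r, c) diff (delta c) (cell r).1 (cell r).2.

Definition gen_mx : 'M[S]_(1, size (cells 0)) := \row_c gen (cell c).1.

Lemma cube_mxE i v r : (cube_mx i *m v) r 0 = diff (chain v) (cell r).1 (cell r).2.
Proof.
rewrite mxE /cube_mx /cube_diff.
under eq_bigr => c _ do rewrite mxE mulr_suml.
rewrite exchange_big; apply: eq_bigr => j _ /=.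
rewrite /chain !mulr_sumr -sumrB mulr_sumr; apply: eq_bigr => c _ /=; ring.
Qed.

Lemma gen_mxE v : gen_mx *m v = (augment X fv k E (chain v))%:M.
Proof.
have [Eu _ _ _] := EP.
apply/matrixP=> a b; rewrite !ord1 !mxE eqxx mulr1n /augment.
under [RHS]eq_bigr => c _ do rewrite mulr_sumr.
rewrite exchange_big; apply: eq_bigr => c _ /=; rewrite mxE.
have := cell_mem c; rewrite [cell c]surjective_pairing mem_cells.
case/and3P=> cE _; rewrite cards_eq0 => /eqP c0.
rewrite (bigD1_seq (cell c).1) //= big1 => [|b' ne].
  have -> : delta c (cell c).1 set0 = 1.
    by rewrite /delta [X in _ == X]surjective_pairing c0 eqxx.
  by rewrite mulr1 addr0 mulrC.
by rewrite /delta [X in _ == X]surjective_pairing xpair_eqE (negPf ne) !mulr0.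
Qed.

(** By the bound [b j <= k], every factor has degree exactly [k]. *)
Lemma mhom_gen b : b \in E -> mhom (\sum_(j | fv j != j) k) (gen b).
Proof.
have [_ _ Ek _] := EP => bE.
apply: (big_rec2 (fun d p => mhom d p)); first exact: mhom1.
move=> j d p _ hp; rewrite -mulrA.
have -> : (k + d = (k - b j) + (b j + d))%N by rewrite addnA subnK ?Ek.
by apply: mhomXM; apply: mhomXM.
Qed.

Lemma mhom_cube_mx i r c : mhom 1 (cube_mx i r c).
Proof.
rewrite mxE; apply: mhom_sum => j _.
have hdelta b s : mhom 0 (delta c b s).
  by rewrite /delta; case: eqP => _; [apply: mhom1 | apply: mhom0].
rewrite /koszul_sign -signr_odd; case: odd; rewrite ?expr0 ?expr1 ?mul1r ?mulN1r.
  by apply/mhomN/mhomD; [|apply/mhomN]; apply: mhomVM.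
by apply: mhomD; [|apply/mhomN]; apply: mhomVM.
Qed.

Lemma chain_cube_mx i v b s : chain (cube_mx i *m v) b s = diff (chain v) b s.
Proof.
rewrite -[RHS](columnK (i := i)); last exact/(cube_diff_supp EP)/chain_supp.
congr (chain _ b s); apply/matrixP=> r a; rewrite ord1 cube_mxE mxE //.
Qed.

Lemma chain_inj i v w : (forall b s, chain (i := i) v b s = chain w b s) -> v = w.
Proof. by move=> E'; apply/matrixP=> c a; rewrite ord1 -!chain_cell E'. Qed.

Lemma chain0 i b s : chain (0 : 'cV_(size (cells i))) b s = 0.
Proof. by rewrite /chain big1 // => c _; rewrite mxE mul0r. Qed.

Lemma cube_mxK i (v : 'cV_(size (cells i.+2))) : cube_mx i *m (cube_mx i.+1 *m v) = 0.
Proof.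
apply: chain_inj => b s; rewrite chain0 chain_cube_mx.
by rewrite (eq_cube_diff _ _ (chain_cube_mx v)) cube_diffK.
Qed.

(** Homological degree [i] is free on the cubes of dimension [i]; exactness is carried over from
    chains to columns. *)
Lemma cube_linear_resolution (I : S -> Prop) :
  (forall f, ideal_span (fun g => exists2 b, b \in E & g = gen b) f <-> I f) ->
  has_linear_resolution I.
Proof.
move=> EI; exists (\sum_(j | fv j != j) k)%N, (fun i => size (cells i)), gen_mx, cube_mx.
have exact i (v : 'cV_(size (cells i))) : (forall b s, diff (chain (i := i) v) b s = 0) ->
    (i = 0%N -> augment X fv k E (chain v) = 0) -> exists w, v = cube_mx i *m w.
  move=> dv0 av0; have [w wE Ew] := exact_cube qD qK qM fvK EP (@chain_supp _ v) dv0 av0.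
  exists (column i.+1 w); apply: chain_inj => b s.
  by rewrite chain_cube_mx -Ew; apply: eq_cube_diff => c t; rewrite columnK.
split=> [j|].
  rewrite mxE; apply: mhom_gen; have := cell_mem j.
  by rewrite [cell j]surjective_pairing mem_cells => /and3P [].
split=> [f|].
  rewrite -EI; split=> [] [s [sA ->]]; exists s; split=> // p /sA.
    move=> [j ->]; exists (cell j).1; last by rewrite mxE.
    by have := cell_mem j; rewrite [cell j]surjective_pairing mem_cells => /and3P [].
  move=> [b bE ->]; have /cellP [j Ej] : (b, set0) \in cells 0.
    by rewrite mem_cells bE sub0set cards0.
  by exists j; rewrite mxE Ej.
split; first exact: mhom_cube_mx.
split=> [v|]; [split=> [Ev|[w ->]] | split=> [i v|]; [split=> [Ev|[w ->]] |]].
- apply: exact => [b s|_]; first last.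
    by have := gen_mxE v; rewrite Ev => /matrixP /(_ 0 0); rewrite !mxE eqxx.
  (* A chain of degree zero is supported at [set0], so its differential vanishes by itself and only
     the augmentation is a condition. *)
  rewrite /cube_diff big1 // => j js.
  have v0 b' : chain v b' (j |: s) = 0.
    by apply/eqP; apply: contraT => /chain_supp /and3P [_ _]; rewrite cardsU1 js.
  by rewrite !v0; ring.
- rewrite gen_mxE /augment; have := @augment_cube_diff _ _ X _ _ _ _ EP (@chain_supp _ w).
  rewrite /augment; under eq_bigr => b _ do rewrite -chain_cube_mx.
  by move=> ->; rewrite raddf0.
- apply: exact => // b s; by rewrite -chain_cube_mx Ev chain0.
- exact: cube_mxK.
(* No subset of ['I_n] has [n + 1] elements, so there are no cells in this degree. *)
exists n.+1; apply/eqP; rewrite size_eq0; apply/eqP.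
case Ec: (cells n.+1) => [|[b s] r] //.
have : (b, s) \in cells n.+1 by rewrite Ec mem_head.
rewrite mem_cells => /and3P [_ _ /eqP cs].
by have := max_card (mem s); rewrite cs card_ord ltnn.
Qed.

End Matrices.

(** * Generators of ideals and of their powers *)

Section IdealSpan.
Context (S : comNzRingType).
Implicit Types (A B C : S -> Prop) (f g h : S).

Lemma span0 A : ideal_span A 0.
Proof. by exists [::]; rewrite big_nil. Qed.

Lemma spanD A f g : ideal_span A f -> ideal_span A g -> ideal_span A (f + g).
Proof.
move=> [s [sA ->]] [t [tA ->]]; exists (s ++ t); rewrite big_cat; split=> // p.
by rewrite mem_cat => /orP [/sA|/tA].
Qed.

Lemma spanZ A f g : ideal_span A g -> ideal_span A (f * g).
Proof.
move=> [s [sA ->]]; exists [seq (f * p.1, p.2) | p <- s]; split.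
  by move=> _ /mapP [p ps ->]; exact: (sA p).
by rewrite big_map mulr_sumr; apply: eq_bigr => p _; rewrite mulrA.
Qed.

Lemma span_mem A f : A f -> ideal_span A f.
Proof.
move=> Af; exists [:: (1, f)]; rewrite big_seq1 mul1r; split=> // p.
by rewrite inE => /eqP ->.
Qed.

Lemma span_sub A B f : (forall g, A g -> ideal_span B g) -> ideal_span A f -> ideal_span B f.
Proof.
move=> AB [s [sA ->]]; rewrite big_seq_cond; apply: big_ind => [||p].
- exact: span0.
- exact: spanD.
- by rewrite andbT => /sA /AB; apply: spanZ.
Qed.

Lemma spanM A B C f g :
  (forall a b, A a -> B b -> ideal_span C (a * b)) ->
  ideal_span A f -> ideal_span B g -> ideal_span C (f * g).
Proof.
move=> ABC [s [sA ->]] Bg; rewrite mulr_suml big_seq_cond.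
apply: big_ind => [||p]; [exact: span0 | exact: spanD |].
rewrite andbT => /sA Ap; rewrite -mulrA; apply: spanZ.
case: Bg => t [tB ->]; rewrite mulr_sumr big_seq_cond.
apply: big_ind => [||r]; [exact: span0 | exact: spanD |].
by rewrite andbT => /tB Br; rewrite mulrCA; apply/spanZ/ABC.
Qed.

(** A product of [k] combinations of generators expands, one factor at a time, into products of [k]
    generators. *)
Lemma ideal_pow_span A k f :
  ideal_pow (ideal_span A) k f <->
  ideal_span (fun g => exists s : seq S,
    size s = k /\ (forall h, h \in s -> A h) /\ g = \prod_(h <- s) h) f.
Proof.
split; apply: span_sub => _ [s [<- [sA ->]]]; last first.
  apply: span_mem; exists s; split=> //; split=> // h /sA; exact: span_mem.
elim: s sA => [|g s IHs] sA /=.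
  by apply: span_mem; exists [::].
rewrite big_cons; apply: (spanM _ (sA g (mem_head _ _)) (IHs _)).
  move=> a _ Aa [t [<- [tA ->]]]; apply: span_mem; exists (a :: t); rewrite big_cons.
  by split=> //; split=> // h; rewrite inE => /orP [/eqP ->|/tA].
by move=> h hs; apply: sA; rewrite inE hs orbT.
Qed.

End IdealSpan.

(** * Minimal vertex covers and independent sets *)

Section Covers.
Context (n : nat) (e : rel 'I_n) (fv : 'I_n -> 'I_n).
Hypotheses (e_sym : symmetric e) (e_irr : irreflexive e).
Hypothesis fvK : forall j, fv (fv j) = fv j.
Hypothesis fv_nbr : forall j l, e (fv j) l -> fv l = fv j.
Hypothesis fv_adj : forall j l, fv j = fv l -> j != l -> e j l.
Context (S : comNzRingType) (X : 'I_n -> S).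

(** As [fv] is idempotent, [fv x != x] means that [x] is not a chosen free vertex. *)
Definition nonfree_indep (A : {set 'I_n}) : bool :=
  [forall x in A, (fv x != x) && [forall y in A, ~~ e x y]].

Lemma nonfree_indepP (A : {set 'I_n}) : reflect
  ((forall x, x \in A -> fv x != x) /\ (forall x y, x \in A -> y \in A -> ~~ e x y))
  (nonfree_indep A).
Proof.
apply: (iffP forall_inP) => [gA|[AW Ai] x xA].
  split=> [x /gA /andP [] //|x y /gA /andP [_ /forall_inP]]; exact.
by rewrite AW //=; apply/forall_inP=> y; apply: Ai.
Qed.

(** This is [gen] for [k = 1] at the indicator of [A]. *)
Definition cover_mon (A : {set 'I_n}) : S :=
  \prod_(j | fv j != j) (if j \in A then X (fv j) else X j).

(* The complement of the unique extension of [A] to a transversal of the facets by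
   free vertices. *)
Definition cover_of (A : {set 'I_n}) : {set 'I_n} :=
  [set j | fv j != j] :\: A :|: fv @: A.

Lemma nonfree_indep_inj A : nonfree_indep A -> {in A &, injective fv}.
Proof.
move=> /nonfree_indepP [_ Ai] x y xA yA E; apply/eqP; apply: contraT => /(fv_adj E) exy.
by have := Ai x y xA yA; rewrite exy.
Qed.

(** Vertices of one facet are adjacent, so [A] meets each facet at most once and the factors
    [X (fv j)] with [j] in [A] belong to distinct vertices. *)
Lemma cover_monE A : nonfree_indep A -> cover_mon A = \prod_(j in cover_of A) X j.
Proof.
move=> gA; have /nonfree_indepP [AW _] := gA.
rewrite /cover_mon (bigID (mem A)) /= mulrC.
rewrite [RHS](bigID (fun j => fv j != j)) /=; congr (_ * _).
  apply: eq_big => [j|j /andP [_ /negPf -> //]].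
  rewrite !inE; case: (boolP (j \in A)) => //= jA.
    rewrite andbF; apply/esym/negbTE; rewrite negb_and negbK.
    case: (boolP (j \in fv @: A)) => //= /imsetP [l lA ->]; by rewrite fvK eqxx.
  rewrite !andbT; case: eqP => //=; rewrite ?andbF //.
transitivity (\prod_(j in A) X (fv j)).
  apply: eq_big => [j|j /andP [_ ->] //]; apply: andb_idl; exact: AW.
rewrite -(big_imset _ (nonfree_indep_inj gA)); apply: eq_bigl => j.
rewrite !inE negbK; apply/idP/idP => [/imsetP [l lA ->]|].
  by rewrite fvK eqxx imset_f ?orbT.
by case/andP=> /orP [/andP [_ /negP] ne /ne //|].
Qed.

(** An edge at a chosen vertex stays inside its facet, where just one vertex is missed; the other
    edges are covered because [A] is independent. For minimality, each vertex of the cover has a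
    neighbour outside it. *)
Lemma cover_of_min A : nonfree_indep A -> is_min_vertex_cover e (cover_of A).
Proof.
move=> gA; have /nonfree_indepP [AW Ai] := gA.
have fixE x y : e x y -> fv x = x -> x \notin cover_of A -> y \in cover_of A.
  move=> exy fx; rewrite !inE negb_or => /andP [_ xA].
  have fy : fv y = x by rewrite -fx; apply: fv_nbr; rewrite fx.
  have yx : y != x by apply: contraTneq exy => ->; rewrite e_irr.
  rewrite fy eq_sym yx andbT; case: (boolP (y \in A)) => //= yA.
  by case/negP: xA; rewrite -fy imset_f.
have covA : is_vertex_cover e (cover_of A).
  apply/forallP=> x; apply/forallP=> y; apply/implyP=> exy.
  case: (boolP (x \in _)) => //= xC; have [fx|fx] := eqVneq (fv x) x.
    exact: fixE exy fx xC.
  apply: contraT => yC; have [fy|fy] := eqVneq (fv y) y.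
    by have := fixE y x; rewrite e_sym (negPf xC) => /(_ exy fy yC).
  move: xC yC; rewrite !inE fx fy !andbT !negb_or !negbK => /andP [xA _] /andP [yA _].
  by have := Ai x y xA yA; rewrite exy.
apply/minsetP; split=> // B covB BC; apply/eqP; rewrite eqEsubset BC.
apply/subsetP=> z zC; apply: contraT => zB.
have nbr m : e z m -> m \in B.
  by move=> ezm; have := forallP (forallP covB z) m; rewrite ezm (negPf zB).
suff [m ezm mC] : exists2 m, e z m & m \notin cover_of A.
  by have := subsetP BC m (nbr _ ezm); rewrite (negPf mC).
have notA m : m \in A -> m \notin cover_of A.
  move=> mA; rewrite !inE mA /=; apply/negP=> /imsetP [l lA E].
  by have := AW m mA; rewrite E fvK eqxx.
move: zC; rewrite !inE => /orP [/andP [zA fz]|/imsetP [l lA ->]]; last first.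
  exists l; last exact: notA.
  by apply: fv_adj; rewrite ?fvK // AW.
(* The missed neighbour is the vertex of [A] in the facet of [z], or the chosen vertex of that facet
   if there is none. *)
have [/imsetP [m mA E]|nfz] := boolP (fv z \in fv @: A).
  exists m; last exact: notA.
  by apply: fv_adj => //; apply: contraNneq zA => ->.
exists (fv z); first by apply: fv_adj; rewrite ?fvK // eq_sym.
by rewrite !inE fvK eqxx andbF.
Qed.

Lemma min_cover_of C : is_min_vertex_cover e C -> exists2 A, nonfree_indep A & C = cover_of A.
Proof.
move=> /minsetP [covC Cmin]; pose A := [set j | fv j != j] :\: C.
have AC x : x \in A -> x \notin C by rewrite !inE => /andP [].
have Ai x y : x \notin C -> y \notin C -> ~~ e x y.
  move=> /negPf xC /negPf yC; apply/negP=> exy.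
  by have := forallP (forallP covC x) y; rewrite exy xC yC.
exists A.
  apply/nonfree_indepP; split=> [x|x y /AC xC /AC]; last exact: Ai.
  by rewrite !inE => /andP [].
apply/setP=> v; rewrite [in RHS]inE [v \in _ :\: A]inE.
have [fv_v|ne] := eqVneq (fv v) v; last first.
  rewrite !inE ne !andbT negbK; case: (boolP (v \in C)) => //= vC.
  by apply/esym/negbTE/negP=> /imsetP [l _ E]; move: ne; rewrite E fvK eqxx.
rewrite !inE fv_v eqxx andbF /=; apply/idP/imsetP => [vC|[l lA E]]; last first.
  apply: contraT => vC; have := Ai _ _ (AC _ lA) vC.
  by rewrite fv_adj // E ?fvK //; move: lA; rewrite !inE eq_sym => /andP [].
(* By minimality, dropping [v] uncovers an edge; it ends at [v], and its other end is a missed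
   vertex of the facet of [v]. *)
have : ~~ is_vertex_cover e (C :\ v).
  apply/negP=> /Cmin /(_ (subD1set _ _)) E.
  by move: vC; rewrite -E !inE eqxx.
have nbr z : e v z -> z \notin C :\ v -> exists2 x, x \in A & v = fv x.
  move=> evz; have zv : z != v by apply: contraTneq evz => ->; rewrite e_irr.
  rewrite !inE zv /= => zC; have fz : fv z = v by rewrite -fv_v; apply: fv_nbr; rewrite fv_v.
  by exists z; rewrite ?fz // !inE zC fz eq_sym.
rewrite negb_forall => /existsP [x]; rewrite negb_forall => /existsP [y].
rewrite negb_imply negb_or => /and3P [exy xC yC].
have [xv|xv] := eqVneq x v; first by apply: (nbr y) => //; rewrite -xv.
have [yv|yv] := eqVneq y v; first by apply: (nbr x) => //; rewrite -yv e_sym.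
move: xC yC; rewrite !inE xv yv /= => xC yC.
by have := Ai x y xC yC; rewrite exy.
Qed.

Definition mult (t : seq {set 'I_n}) : {ffun 'I_n -> nat} :=
  [ffun j => count (fun A : {set 'I_n} => j \in A) t].

Lemma prod_cover_mon t : \prod_(A <- t) cover_mon A = gen X fv (size t) (mult t).
Proof.
rewrite exchange_big; apply: eq_bigr => j _; rewrite ffunE.
elim: t => [|A t IHt] /=; first by rewrite big_nil !expr0 mulr1.
rewrite big_cons IHt; have := count_size (fun B : {set 'I_n} => j \in B) t.
set c := count _ _ => ct; case: ifP => _; rewrite ?add1n ?add0n.
  by rewrite subSS exprS; ring.
by rewrite subSn // exprS; ring.
Qed.

(** Distinct families may have the same multiplicities and hence the same generator, so duplicates
    are removed. *)
Definition mults (k : nat) : seq {ffun 'I_n -> nat} :=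
  undup [seq mult t | t : k.-tuple {set 'I_n} <- enum {: k.-tuple {set 'I_n}}
         & all nonfree_indep t].

Lemma multsP k (b : {ffun 'I_n -> nat}) :
  reflect (exists t, [/\ size t = k, all nonfree_indep t & b = mult t])
    (b \in mults k).
Proof.
rewrite mem_undup; apply: (iffP mapP) => [[t]|[t [tk gt ->]]].
  by rewrite mem_filter => /andP [gt _] ->; exists t; rewrite size_tuple.
exists (tcast tk (in_tuple t)); rewrite ?val_tcast //.
by rewrite mem_filter val_tcast /= gt mem_enum.
Qed.

Lemma nonfree_indep_sub (A B : {set 'I_n}) : A \subset B -> nonfree_indep B -> nonfree_indep A.
Proof.
move=> /subsetP AB /nonfree_indepP [BW Bi]; apply/nonfree_indepP.
by split=> [x /AB /BW //|x y /AB xB /AB]; apply: Bi.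
Qed.

(** It suffices to remove [j] from one member containing it, since subsets of independent sets are
    independent. *)
Lemma mult_dec t b j : all nonfree_indep t -> mult t = inc j b ->
  exists t', [/\ size t' = size t, all nonfree_indep t' & mult t' = b].
Proof.
elim: t b => [|A t IHt] b /=.
  by move=> _ /ffunP /(_ j); rewrite !ffunE eqxx addn1.
case/andP=> gA gt E; have El l : ((l \in A) + mult t l = b l + (l == j))%N.
  by move/ffunP: E => /(_ l); rewrite !ffunE.
have [jA|jA] := boolP (j \in A).
  exists (A :\ j :: t); rewrite /= gt (nonfree_indep_sub _ gA) ?subD1set //; split=> //.
  apply/ffunP=> l; have := El l; rewrite !ffunE /= !inE.
  by case: eqVneq => [->|_] /=; rewrite ?jA; lia.
(* The truncated subtraction is exact: as [j] is not in [A], [El] gives [0 < b l] for [l] in [A]. *)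
have [||t' [st' gt' Et']] := IHt [ffun l => (b l - (l \in A))%N] => //.
  apply/ffunP=> l; have := El l; rewrite !ffunE; case: eqVneq => [->|_] /=.
    by rewrite (negPf jA); lia.
  by lia.
exists (A :: t'); rewrite /= st' gA; split=> //; apply/ffunP=> l.
have := El l; have /ffunP /(_ l) := Et'; rewrite !ffunE /=.
by case: eqVneq => [->|_] /=; rewrite ?(negPf jA); case: (l \in A) => /=; lia.
Qed.

Lemma mults_downset k : is_downset fv k (mults k).
Proof.
split=> [|b j /multsP [t [<- gt Et]]|b j /multsP [t [<- _ ->]]|b j /multsP [t [_ gt ->]]].
- exact: undup_uniq.
- have [t' [st' gt' Et']] := mult_dec gt (esym Et).
  by apply/multsP; exists t'.
- by rewrite ffunE; apply: count_size.
- rewrite ffunE -has_count => /hasP [A At jA].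
  by have /nonfree_indepP [AW _] := allP gt A At; apply: AW.
Qed.

End Covers.

(* [fv] sends a vertex to a chosen free vertex of the facet of the partition through it. *)
Lemma free_facets_retraction (n : nat) (e : rel 'I_n) :
  symmetric e -> partition (free_facets e) [set: 'I_n] ->
  exists fv : 'I_n -> 'I_n,
    [/\ forall j, fv (fv j) = fv j,
        forall j l, e (fv j) l -> fv l = fv j &
        forall j l, fv j = fv l -> j != l -> e j l].
Proof.
move=> e_sym; set P := free_facets e => /and3P [/eqP covP tIP _].
pose F j := pblock P j.
have inF j : j \in F j by rewrite mem_pblock covP inE.
have FP j : F j \in P by apply: pblock_mem; rewrite covP inE.
have Feq l j : l \in F j -> F l = F j by apply: def_pblock.
pose fv j := odflt j [pick v | free_vertex e (F j) v].
have fvP j : free_vertex e (F j) (fv j).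
  rewrite /fv; case: pickP => //= none.
  by have := FP j; rewrite inE => /andP [_ /existsP [v]]; rewrite none.
(* The pick depends only on the block; the default, which depends on the vertex, is never reached
   because each block has a free vertex. *)
have fvF l j : F l = F j -> fv l = fv j.
  move=> E; have := fvP j; rewrite /fv E; case: pickP => //= none.
  by have := FP j; rewrite inE => /andP [_ /existsP [v]]; rewrite none.
have Ffv j : F (fv j) = F j by apply: Feq; case/andP: (fvP j).
have clF j : is_clique e (F j).
  by have := FP j; rewrite inE => /andP [/maxsetP []].
exists fv; split=> [j|j l ejl|j l E ne].
- exact/fvF/Ffv.
(* The edge from [fv j] to [l] lies in some facet; containing the free vertex [fv j], this facet is
   [F j]. *)
- apply/fvF/Feq; have cl : is_clique e [set fv j; l].
    apply/forall_inP=> x; rewrite !inE => /orP [] /eqP ->; apply/forall_inP=> y;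
      rewrite !inE => /orP [] /eqP ->; rewrite ?eqxx ?ejl ?implybT //.
    by rewrite e_sym ejl implybT.
  have [F' F'max /subsetP sub] := maxset_exists cl.
  have /andP [_ /forallP /(_ F')] := fvP j.
  rewrite /is_facet F'max sub ?inE ?eqxx //= implybF negbK => /eqP <-.
  by rewrite sub // !inE eqxx orbT.
have FE : F j = F l by rewrite -(Ffv j) E Ffv.
have /forall_inP /(_ j (inF j)) /forall_inP /(_ l) := clF j.
by rewrite ne /=; apply; rewrite FE.
Qed.

(** * Powers of the vertex cover ideal *)

Theorem theorem2p7 (K : fieldType) (n : nat) (e : rel 'I_n)
  (e_sym : symmetric e) (e_irr : irreflexive e)
  (Hpart : partition (free_facets e) [set: 'I_n])
  (k : nat) (hk : (1 <= k)%N) :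
  has_linear_resolution (ideal_pow (@vertex_cover_ideal K n e) k).
Proof.
have [fv [fvK fv_nbr fv_adj]] := free_facets_retraction e_sym Hpart.
apply: (cube_linear_resolution fvK (mults_downset e fv k)) => f.
rewrite /vertex_cover_ideal ideal_pow_span.
pose X (j : 'I_n) := mvar K n j.
(* Both inclusions exchange families of [k] minimal covers with families of [k] independent sets,
   whose product of cover monomials is [gen] at the sum of the indicators. *)
split; apply: span_sub => g; [move=> [b /multsP [t [<- gt ->]] ->] | move=> [s [sk [sA ->]]]].
  apply: span_mem; exists [seq cover_mon fv X A | A <- t].
  rewrite size_map big_map prod_cover_mon.
  split=> //; split=> // _ /mapP [A At ->]; have gA := allP gt A At.
  by exists (cover_of fv A); rewrite (cover_of_min e_sym) // (cover_monE fvK fv_adj).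
suff [t [st gt ->]] : exists t, [/\ size t = size s, all (nonfree_indep e fv) t &
    \prod_(h <- s) h = \prod_(A <- t) cover_mon fv X A].
  apply: span_mem; exists (mult t); last by rewrite prod_cover_mon st sk.
  by apply/multsP; exists t; rewrite st sk.
elim: s {sk} sA => [|h s IHs] sA; first by exists [::]; rewrite !big_nil.
have [t [st gt Et]] : exists t, [/\ size t = size s, all (nonfree_indep e fv) t &
    \prod_(h <- s) h = \prod_(A <- t) cover_mon fv X A].
  by apply: IHs => h' hs; apply: sA; rewrite inE hs orbT.
have [C [/(min_cover_of e_sym e_irr fvK fv_nbr fv_adj) [A gA ->] Eh]] := sA h (mem_head _ _).
exists (A :: t); rewrite /= st gA gt !big_cons Et Eh.
by rewrite (cover_monE fvK fv_adj).
Qed.
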